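(* For all integers $n,m\ge 0$ there is a diffeomorphism (of diffeological spaces, both carrying the subset diffeology from $\mathbb{R}^{n+m}$) $\Psi_{n,m}:\mathbb{R}^n\times D^m\to\mathbb{D}^{n,m}$.
   Context: Let $\ell(t)=0$ for $t\le0$, $\ell(t)=e^{-1/t}$ for $t>0$; $\alpha_0=\int_0^1\ell(3x)\ell(3-3x)\,dx$; $\lambda(t)=\frac1{\alpha_0}\int_0^t\ell(3x)\ell(3-3x)\,dx$; $\phi(t)=\int_0^{1/2+t}\lambda(x)\,dx$. $\|\cdot\|$ is the Euclidean norm; $\mathbb{R}^0$ is a point. $\mathbb{D}^{n,m}=\{(u,v)\in\mathbb{R}^n\times\mathbb{R}^m:\ \|u\|\ge1-\phi(2-\|u\|-\|v\|)\}$; $D^m=\{v\in\mathbb{R}^m:\|v\|\le1\}$. A subset of $\mathbb{R}^N$ carries the subset diffeology: plots are maps from open subsets of Euclidean spaces that are smooth as maps into $\mathbb{R}^N$. *)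

(* Defs.v *)
From HB Require Import structures.
From mathcomp Require Import all_boot all_order all_algebra.
From mathcomp Require Import all_classical all_reals all_analysis.
Set Implicit Arguments. Unset Strict Implicit. Unset Printing Implicit Defensive.
Import Order.TTheory GRing.Theory Num.Theory.
Import numFieldNormedType.Exports.
Local Open Scope classical_set_scope.
Local Open Scope ring_scope.

Section Defs.
Variable R : realType.

Definition oint (a b : R) (f : R -> R) : R :=
  if a <= b then Rintegral lebesgue_measure `[a, b] f
  else - Rintegral lebesgue_measure `[b, a] f.

Definition ell (t : R) : R := if t <= 0 then 0 else expR (- t^-1).

Definition bump (x : R) : R := ell (3 * x) * ell (3 - 3 * x).

Definition alpha0 : R := oint 0 1 bump.

Definition lam (t : R) : R := alpha0^-1 * oint 0 t bump.

Definition phi (t : R) : R := oint 0 (2^-1 + t) lam.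

Definition enorm k (v : 'rV[R]_k) : R := Num.sqrt (\sum_(i < k) v ord0 i ^+ 2).

Definition RnDm n m : set 'rV[R]_(n + m) :=
  [set w | enorm (rsubmx w) <= 1].

Definition DDnm n m : set 'rV[R]_(n + m) :=
  [set w | enorm (lsubmx w) >= 1 - phi (2 - enorm (lsubmx w) - enorm (rsubmx w))].

Definition ebasis k (j : 'I_k) : 'rV[R]_k := delta_mx ord0 j.

Fixpoint ipartial k N (js : seq 'I_k) (f : 'rV[R]_k -> 'rV[R]_N)
  : 'rV[R]_k -> 'rV[R]_N :=
  match js with
  | [::] => f
  | j :: js' => fun x => 'D_(ebasis j) (ipartial js' f) x
  end.

Definition smooth_on k N (U : set 'rV[R]_k) (f : 'rV[R]_k -> 'rV[R]_N) : Prop :=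
  forall js : seq 'I_k, forall x, U x ->
    {for x, continuous (ipartial js f)} /\
    (forall j : 'I_k, derivable (ipartial js f) x (ebasis j)).

Definition is_plot N (A : set 'rV[R]_N) k (U : set 'rV[R]_k)
  (p : 'rV[R]_k -> 'rV[R]_N) : Prop :=
  open U /\ smooth_on U p /\ (forall x, U x -> A (p x)).

Definition dsmooth N M (A : set 'rV[R]_N) (B : set 'rV[R]_M)
  (f : 'rV[R]_N -> 'rV[R]_M) : Prop :=
  (forall x, A x -> B (f x)) /\
  forall k (U : set 'rV[R]_k) p, is_plot A U p -> is_plot B U (f \o p).

Definition diffeomorphic N M (A : set 'rV[R]_N) (B : set 'rV[R]_M) : Prop :=
  exists (f : 'rV[R]_N -> 'rV[R]_M) (g : 'rV[R]_M -> 'rV[R]_N),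
    [/\ dsmooth A B f, dsmooth B A g,
        (forall x, A x -> g (f x) = x) & (forall y, B y -> f (g y) = y)].
End Defs.

(* Main.v *)
(** Put h(s) = s - 1 + phi(2 - s).  Then h = 1 for s <= 3/2, h(s) = s - 1 for
    s >= 5/2, 0 <= h' <= 1, and (u, v) lies in D^{n,m} iff |v| <= h(|u| + |v|).
    Let w(r) = h(4 r + 1) / 4, so that w(r) = r for r >= 3/8 while w is constant
    near 0; hence N(x) = w(|x|) is a smooth positive function on all of R^k.
    With T(u, v) = N(u) + N(v), stretch v by the factor h(T) and rescale u by
    the positive factor that keeps T fixed:
      (u, v) |-> ((1 + (N(v) - N(h(T) v)) / N(u)) u, h(T) v).
    Since T is preserved, the inverse is the same formula with 1 / h(T) in place
    of h(T).  Both maps are smooth on the whole of R^{n+m}, and the identity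
    where T <= 3/2; where T > 3/2, points of either domain have |u| >= 1/2, so
    that N(u) = |u|. *)
From HB Require Import structures.
From mathcomp Require Import all_boot all_order all_algebra.
From mathcomp Require Import all_classical all_reals all_analysis.
From mathcomp Require Import ring lra.
Require Import Defs.
Set Implicit Arguments. Unset Strict Implicit. Unset Printing Implicit Defensive.
Import Order.TTheory GRing.Theory Num.Theory.
Import numFieldNormedType.Exports.
Local Open Scope classical_set_scope.
Local Open Scope ring_scope.

(** * Finite smoothness classes: closure properties and the chain rule *)

Section Ck.
Context {R : realType}.

(* Class C^r on [U], with iterated directional derivatives along vectors of [B]
   only: [B] is the canonical basis on ['rV_k] and [{1}] on [R].  The partial
   derivatives are existential because their values off [U] are irrelevant. *)
Fixpoint Ck (V W : normedModType R) (r : nat) (B U : set V) (f : V -> W) :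
    Prop :=
  (forall x, U x -> {for x, continuous f}) /\
  if r is r'.+1 then
    forall v, B v ->
      exists2 f', (forall x, U x -> is_derive x v f (f' x)) & Ck r' B U f'
  else True.

Section general.
Variables (V W : normedModType R).
Implicit Types (B U : set V) (f g : V -> W) (r : nat).

Lemma Ck_continuous r B U f : Ck r B U f ->
  forall x, U x -> {for x, continuous f}.
Proof. by case: r => [|r] []. Qed.

Lemma CkS r B U f : Ck r.+1 B U f -> Ck r B U f.
Proof.
elim: r f => [|r IH] f [cf df]; split=> // v /df[f' df' Cf'].
by exists f' => //; exact: IH.
Qed.

Lemma Ck_eq r B U f g : open U -> (forall x, U x -> f x = g x) ->
  Ck r B U f -> Ck r B U g.
Proof.
move=> oU fg; have nfg x : U x -> \near x, f x = g x.
  by move=> Ux; near=> y; apply: fg; near: y; exact: open_nbhs_nbhs.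
have cfg x : U x -> {for x, continuous f} -> {for x, continuous g}.
  move=> Ux cf; have {}cf : f y @[y --> x] --> g x by rewrite -(fg _ Ux).
  by apply: cvg_trans cf; apply: near_eq_cvg; exact: nfg.
case: r => [|r] [cf df]; (split; first by move=> x Ux; exact/cfg/cf) => //.
move=> v /df[f' df' Cf']; exists f' => // x Ux.
by apply: near_eq_is_derive (nfg _ Ux) _; exact: df'.
Unshelve. all: by end_near. Qed.

(** The derivative witnesses on [U] and [U'] may differ, so both are replaced by ['D_v f], which
    equals each of them on its own set. *)
Lemma Ck_setU r B U U' f : open U -> open U' ->
  Ck r B U f -> Ck r B U' f -> Ck r B (U `|` U') f.
Proof.
move=> oU oU'; elim: r f => [|r IH] f [cf df] [cf' df']; (split;
  first by move=> x [/cf|/cf']) => //.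
move=> v Bv; have [f1 df1 C1] := df _ Bv; have [f2 df2 C2] := df' _ Bv.
exists ('D_v f).
  by move=> x [/df1|/df2] [? _]; exact: derivableP.
by apply: IH; [apply: Ck_eq C1 => // x /df1|apply: Ck_eq C2 => // x /df2];
   move=> [_ ->].
Qed.

Lemma Ck_cst r B U (a : W) : Ck r B U (cst a).
Proof.
elim: r a => [|r IH] a; (split;
  first by move=> x _; exact: cst_continuous) => // v _.
by exists (cst 0) => // x _; exact: is_derive_cst.
Qed.

Lemma CkD r B U f g : Ck r B U f -> Ck r B U g -> Ck r B U (f + g).
Proof.
elim: r f g => [|r IH] f g [cf df] [cg dg]; (split;
  first by move=> x Ux; apply: continuousD; [exact: cf|exact: cg]) => //.
move=> v Bv; have [f' df' Cf'] := df _ Bv; have [g' dg' Cg'] := dg _ Bv.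
exists (f' + g'); last exact: IH.
by move=> x Ux; apply: is_deriveD; [exact: df'|exact: dg'].
Qed.

End general.

Lemma Ck_id (V : normedModType R) r (B U : set V) : Ck r B U (id : V -> V).
Proof.
case: r => [|r]; (split; first by move=> x _; exact: cvg_id) => // v _.
by exists (cst v); [move=> x _; exact: is_derive_id|exact: Ck_cst].
Qed.

Section scalar.
Variables (V : normedModType R).
Implicit Types (B U : set V) (f g : V -> R) (r : nat).

Lemma CkM r B U f g : Ck r B U f -> Ck r B U g -> Ck r B U (f * g).
Proof.
elim: r f g => [|r IH] f g /[dup] Cf [cf df] /[dup] Cg [cg dg]; (split;
  first by move=> x Ux; apply: continuousM; [exact: cf|exact: cg]) => //.
move=> v Bv; have [f' df' Cf'] := df _ Bv; have [g' dg' Cg'] := dg _ Bv.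
exists (f * g' + g * f'); last by apply: CkD; apply: IH => //; exact: CkS.
by move=> x Ux; apply: is_deriveM; [exact: df'|exact: dg'].
Qed.

Lemma CkN r B U f : Ck r B U f -> Ck r B U (- f).
Proof.
move=> Cf; have -> : - f = cst (-1) * f.
  by apply/funext => x /=; rewrite /GRing.mul/= mulN1r.
by apply: CkM => //; exact: Ck_cst.
Qed.

Lemma CkB r B U f g : Ck r B U f -> Ck r B U g -> Ck r B U (f - g).
Proof. by move=> Cf Cg; apply: CkD => //; exact: CkN. Qed.

(** [f] is only derivable along [v], so it is restricted to the line through [x] in direction [v],
    where the one-variable chain rule applies. *)
Lemma is_derive_comp1 (G : R -> R) f x v a b :
  is_derive (f x) 1 G a -> is_derive x v f b -> is_derive x v (G \o f) (a * b).
Proof.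
move=> dG df; set F := fun h : R => f (h *: v + x).
have F0 : F 0 = f x by rewrite /F scale0r add0r.
have DE (k : V -> R) : 'D_v k x = 'D_1 (fun h : R => k (h *: v + x)) (0 : R).
  rewrite /derive; set g1 := fun h => h^-1 *: _; set g2 := fun h => h^-1 *: _.
  suff -> : g1 = g2 by [].
  apply/funext => h; rewrite /g1 /g2 /=.
  by rewrite addr0 scale0r add0r [_%:A]mulr1.
have dF : is_derive (0 : R) 1 F b.
  by case: df => /derivable1P df <-; split => //; rewrite -DE.
have [dGF vGF] : is_derive (0 : R) 1 (G \o F) (a * b).
  by apply: is_derive1_comp; rewrite F0.
by split; [apply/derivable1P|rewrite DE].
Qed.

Lemma Ck_comp r B U (D : set R) (G : R -> R) f : Ck r [set (1 : R)] D G ->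
  Ck r B U f -> (forall x, U x -> D (f x)) -> Ck r B U (G \o f).
Proof.
move=> + + UD; elim: r G => [|r IH] G /[dup] CG [cG dG] /[dup] Cf [cf df];
  (split;
  first by move=> x Ux; apply: continuous_comp; [exact: cf|exact/cG/UD]) => //.
move=> v Bv; have [f' df' Cf'] := df _ Bv; have [G' dG' CG'] := dG _ erefl.
exists ((G' \o f) * f'); last by apply: CkM => //; apply: IH => //; exact: CkS.
by move=> x Ux; apply: is_derive_comp1; [exact/dG'/UD|exact: df'].
Qed.

End scalar.

Lemma is_derive1_continuous (f : R -> R) (x a : R) : is_derive x 1 f a ->
  {for x, continuous f}.
Proof. by case=> /derivable1_diffP/differentiable_continuous. Qed.

Lemma Ck1S r (U : set R) (f f' : R -> R) :
  (forall x, U x -> is_derive x (1 : R) f (f' x)) -> Ck r [set (1 : R)] U f' ->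
  Ck r.+1 [set (1 : R)] U f.
Proof.
move=> df Cf'; split=> [x /df/is_derive1_continuous//|_ ->].
by exists f'.
Qed.

(** The derivative -1/x^2 is a polynomial in the inverse itself, so closure under products carries
    the induction. *)
Lemma Ck_inv r : Ck r [set (1 : R)] [set x : R | x != 0] GRing.inv.
Proof.
elim: r => [|r IH]; first by split=> // x x0; exact: inv_continuous.
apply: (@Ck1S _ _ _ (- (GRing.inv * GRing.inv))); last exact/CkN/CkM.
move=> x x0; have := is_deriveV x0 (is_derive_id x 1).
by rewrite /GRing.scale/= mulr1 expr2 invfM.
Qed.

Lemma Ck_sqrt r : Ck r [set (1 : R)] [set x : R | 0 < x] Num.sqrt.
Proof.
elim: r => [|r IH]; first by split=> // x x0; exact: sqrt_continuous.
apply: (@Ck1S _ _ _ (GRing.inv \o (cst 2 * Num.sqrt))).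
apply: (Ck_comp (@Ck_inv r)); first by apply: CkM => //; exact: Ck_cst.
by move=> x x0 /=; rewrite /GRing.mul/= mulf_neq0 // gt_eqF // sqrtr_gt0.
Qed.

Definition smooth1 (f : R -> R) := forall r, Ck r [set (1 : R)] setT f.

Lemma smooth1_primitive (f f' : R -> R) :
  (forall x, is_derive x (1 : R) f (f' x)) -> smooth1 f' -> smooth1 f.
Proof. by move=> df Cf' r; apply: CkS; apply: Ck1S => // x _; exact: df. Qed.

Lemma smooth1_comp (f g : R -> R) : smooth1 f -> smooth1 g -> smooth1 (f \o g).
Proof. by move=> sf sg r; exact: Ck_comp (sf r) (sg r) _. Qed.

Lemma smooth1_affine (a b : R) : smooth1 (cst a * id + cst b).
Proof.
move=> r; apply: CkD (Ck_cst _ _ _ _).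
by apply: CkM (Ck_id _ _ _); exact: Ck_cst.
Qed.

End Ck.

(** * Smoothness of the flat function [ell] *)

Section ell_smooth.
Context {R : realType}.
Implicit Types (P : {poly R}) (t : R).

(* The derivatives of [ell] are of this form. *)
Definition ellP P t : R := if t <= 0 then 0 else P.[t^-1] * expR (- t^-1).

(** Each monomial is handled by exp(y) >= y^(i+2) / (i+2)!. The exponent -2 is chosen so that, with
    y = 1/h, the difference quotient of [ellP P] at 0 is at most C |h|. *)
Lemma horner_expRN_bound P : exists2 C : R, 0 <= C &
  forall y, 0 < y -> `|P.[y]| * expR (- y) <= C * y ^- 2.
Proof.
exists (\sum_(i < size P) `|P`_i| * (i.+2)`!%:R).
  by apply: sumr_ge0 => i _; rewrite mulr_ge0.
move=> y y0; rewrite expRN ler_pdivlMr ?exprn_gt0// mulrAC.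
rewrite ler_pdivrMr ?expR_gt0//.
rewrite horner_coef (le_trans (ler_wpM2r _ (ler_norm_sum _ _ _))) ?sqr_ge0//.
rewrite !mulr_suml ler_sum // => i _.
rewrite normrM -!mulrA ler_wpM2l // normrX gtr0_norm // -exprD addn2.
have := @expR_ge1Dxn R y i.+1 (ltW y0); set e := expR y => he.
rewrite mulrC -ler_pdivrMr ?ltr0n ?fact_gt0//.
by apply: le_trans he; rewrite lerDr.
Qed.

(** With y = 1/t one has y' = -y^2, so P(y) exp(-y) has derivative y^2 (P - P')(y) exp(-y); at 0 the
    exponential decay forces the derivative 0. *)
Lemma is_derive_ellP P t :
  is_derive t 1 (ellP P) (ellP ('X ^+ 2 * (P - P^`())) t).
Proof.
case: (ltgtP t 0) => [t0|t0|->].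
- rewrite {2}/ellP (ltW t0) /=.
  apply: (near_eq_is_derive (f := cst 0)).
  by near=> s; rewrite /ellP ltW //; near: s; exact: lt_nbhsl.
- rewrite {2}/ellP leNgt t0 /=.
  apply: (near_eq_is_derive
    (f := (horner P \o GRing.inv) * (expR \o (- GRing.inv)))).
    near=> s; rewrite /ellP leNgt ifN // negbK; near: s; exact: lt_nbhsr.
  have dV : is_derive t 1 (GRing.inv : R -> R) (- t ^- 2).
    have := is_deriveV (lt0r_neq0 t0) (is_derive_id t 1).
    by rewrite /GRing.scale/= mulr1.
  have d1 := @is_derive1_comp R (horner P) GRing.inv t _ _
    (is_derive_poly _ _) dV.
  have d2 := @is_derive1_comp R expR (- GRing.inv) t _ _
    (is_derive_expR _) (is_deriveN dV).
  apply: (is_derive_eq (is_deriveM d1 d2)).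
  rewrite -[LHS]/(P.[t^-1] * (expR (- t^-1) * - - t ^- 2) +
    expR (- t^-1) * (P^`().[t^-1] * - t ^- 2)).
  by rewrite hornerM hornerXn hornerD hornerN -exprVn; ring.
rewrite {2}/ellP lexx /=.
have [C C0 HC] := horner_expRN_bound P.
suff H : (fun h => h^-1 *: ((ellP P \o shift (0 : R)) (h *: (1 : R)) -
    ellP P 0)) @ 0^' --> (0 : R).
  by split; [apply/cvg_ex; exists 0|exact: cvg_lim].
have H0 : (fun h : R => C * `|h|) @ 0^' --> (0 : R).
  suff : (fun h : R => C * `|h|) @ 0^' --> C * `|0 : R| by rewrite normr0 mulr0.
  apply: cvgM; first exact: cvg_cst.
  by apply: cvg_within_filter; exact: norm_continuous.
(* The quotient vanishes for h <= 0 and is controlled by [HC] for h > 0. *)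
apply: (@squeeze_cvgr _ _ _ _ (fun h : R => - (C * `|h|))
  (fun h : R => C * `|h|)) => //; last first.
  suff : (fun h : R => - (C * `|h|)) @ 0^' --> (- 0 : R) by rewrite oppr0.
  exact: cvgN.
near=> h; rewrite -ler_norml /= addr0 [_%:A]mulr1 {2}/ellP lexx subr0.
rewrite /ellP; case: ifPn => [_|]; first by rewrite scaler0 normr0 mulr_ge0.
rewrite -ltNge => h0; rewrite normrM normrM (gtr0_norm (expR_gt0 _)).
have hv : 0 < h^-1 by rewrite invr_gt0.
have {}HC := HC _ hv; rewrite (gtr0_norm hv) (gtr0_norm h0).
rewrite (le_trans (ler_wpM2l (ltW hv) HC)) // exprVn invrK expr2.
by rewrite mulrCA mulKf // lt0r_neq0.
Unshelve. all: by end_near. Qed.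

Lemma smooth1_ell : smooth1 (@ell R).
Proof.
have -> : @ell R = ellP 1.
  by apply/funext => t; rewrite /ell /ellP hornerE mul1r.
suff H r : forall P, Ck r [set (1 : R)] setT (ellP P) by move=> r; exact: H.
elim: r => [|r IH] P; last by apply: Ck1S (IH _) => x _; exact: is_derive_ellP.
by split=> // x _; exact: is_derive1_continuous (is_derive_ellP P x).
Qed.

Lemma ell_ge0 t : 0 <= ell t.
Proof. by rewrite /ell; case: ifP => // _; exact: expR_ge0. Qed.

Lemma ell_gt0 t : 0 < t -> 0 < ell t.
Proof. by rewrite /ell => t0; rewrite leNgt t0 /= expR_gt0. Qed.

Lemma ell_le0 t : t <= 0 -> ell t = 0.
Proof. by rewrite /ell => ->. Qed.

End ell_smooth.

(** * The oriented integral as a primitive *)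

Section oint.
Context {R : realType}.
Implicit Types f : R -> R.
Let mu := @lebesgue_measure R.

Lemma continuous_itv_integrable f (a b : R) : continuous f ->
  mu.-integrable `[a, b] (EFin \o f).
Proof.
move=> cf; apply: continuous_compact_integrable; first exact: segment_compact.
exact: continuous_subspaceT.
Qed.

(** A base point below both 0 and [x] turns the two orientations into a single difference of
    integrals, which can be differentiated in [x]. *)
Lemma oint_itvB f (a x : R) : continuous f -> a < 0 -> a < x ->
  oint 0 x f = Rintegral mu `[a, x] f - Rintegral mu `[a, 0] f.
Proof.
move=> cf a0 ax; rewrite /oint; case: leP => x0.
  rewrite Rintegral_itvB ?bnd_simp ?(ltW a0) ?(ltW ax) ?(ltW x0)//;
  last exact: continuous_itv_integrable.
  rewrite Rintegral_itv_obnd_cbnd//.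
  apply: integrableS (continuous_itv_integrable 0 x cf) => //.
  by apply: subset_itv; rewrite bnd_simp.
rewrite -[RHS]opprB Rintegral_itvB ?bnd_simp ?(ltW a0) ?(ltW ax) ?(ltW x0)//;
  last exact: continuous_itv_integrable.
rewrite Rintegral_itv_obnd_cbnd//.
apply: integrableS (continuous_itv_integrable x 0 cf) => //.
by apply: subset_itv; rewrite bnd_simp.
Qed.

Lemma oint_id f (a : R) : oint a a f = 0.
Proof. by rewrite /oint lexx set_itv1 Rintegral_set1. Qed.

Lemma is_derive_oint f (t : R) : continuous f ->
  is_derive t 1 (oint 0 ^~ f) (f t).
Proof.
(* Strictly below both 0 and [t], so that [t] is interior to [a, t + 1]. *)
move=> cf; pose a := Num.min 0 t - 1.
have a0 : a < 0 by rewrite /a ltrBlDr add0r gt_min ltr01.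
have at_ : a < t by rewrite /a ltrBlDr gt_min ltrDl ltr01 orbT.
have t1 : t < t + 1 by rewrite ltrDl.
have [dF F't] := @continuous_FTC1_closed R f a t (t + 1) t1
  (continuous_itv_integrable a (t + 1) cf) at_ (cf t).
have dFP : is_derive t 1 (fun x => Rintegral mu `[a, x] f) (f t).
  by split; rewrite -?derive1E.
apply: (near_eq_is_derive
  (f := (fun x => Rintegral mu `[a, x] f) - cst (Rintegral mu `[a, 0] f))).
  by near=> x; rewrite (@oint_itvB f a) //; near: x; exact: lt_nbhsr.
by rewrite -[f t]subr0; apply: is_deriveB.
Unshelve. all: by end_near. Qed.

End oint.

(** * Consequences of the mean value theorem *)

Section deriv1.
Context {R : realType}.
Implicit Types f df : R -> R.

Lemma MVT_le f df (x y : R) :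
  (forall z, is_derive z (1 : R) f (df z)) -> x <= y ->
  exists2 c, x <= c <= y & f y - f x = df c * (y - x).
Proof.
move=> dfP xy; have [|c] := @MVT_segment R f df x y xy (fun z _ => dfP z).
  by apply: continuous_subspaceT => z; exact: is_derive1_continuous (dfP z).
by rewrite in_itv /= => cxy e; exists c.
Qed.

Lemma is_derive_ge0_le f df (x y : R) :
  (forall z, is_derive z (1 : R) f (df z)) ->
  (forall z, 0 <= df z) -> x <= y -> f x <= f y.
Proof.
move=> dfP df0 xy; have [c _ e] := MVT_le dfP xy.
by rewrite -subr_ge0 e mulr_ge0 // subr_ge0.
Qed.

End deriv1.

(** * The profile functions [lam], [bnd] and [rabs] *)

Section profile.
Context {R : realType}.
Implicit Types s t x y : R.

Lemma smooth1_continuous (f : R -> R) : smooth1 f -> continuous f.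
Proof. by move=> sf x; exact: Ck_continuous (sf 0%N) x I. Qed.

Lemma smooth1_bump : smooth1 (@bump R).
Proof.
have -> : @bump R = (@ell R \o (cst 3 * id + cst 0)) *
    (@ell R \o (cst (-3) * id + cst 3)).
  apply/funext => x; rewrite /bump -[RHS]/(ell (3 * x + 0) * ell (- 3 * x + 3)).
  by congr (ell _ * ell _); ring.
by move=> r; apply: CkM; apply: smooth1_comp smooth1_ell (smooth1_affine _ _) r.
Qed.

Lemma bump_ge0 x : 0 <= bump x.
Proof. by rewrite mulr_ge0 ?ell_ge0. Qed.

Lemma bump_le0 x : x <= 0 -> bump x = 0.
Proof. by move=> x0; rewrite /bump ell_le0 ?mul0r//; lra. Qed.

Lemma bump_ge1 x : 1 <= x -> bump x = 0.
Proof. by move=> x0; rewrite /bump mulrC ell_le0 ?mul0r//; lra. Qed.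

Lemma bump_sym x : bump (1 - x) = bump x.
Proof. by rewrite /bump mulrC; congr (ell _ * ell _); ring. Qed.

Lemma is_derive_oint_bump t : is_derive t 1 (oint 0 ^~ (@bump R)) (bump t).
Proof. exact/is_derive_oint/smooth1_continuous/smooth1_bump. Qed.

(** By the mean value theorem on [0, 1], [alpha0] is the value of [bump] at an interior point, where
    both factors are positive. *)
Lemma alpha0_gt0 : 0 < @alpha0 R.
Proof.
have [|c] := @MVT R _ _ 0 1 ltr01 (fun z _ => is_derive_oint_bump z).
  apply: continuous_subspaceT => z.
  exact: is_derive1_continuous (is_derive_oint_bump z).
rewrite in_itv /= => /andP[c0 c1]; rewrite oint_id !subr0 mulr1 /alpha0 => ->.
by rewrite /bump mulr_gt0 // ell_gt0; lra.
Qed.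

Lemma is_derive_lam t : is_derive t 1 (@lam R) ((alpha0 R)^-1 * bump t).
Proof.
have := is_deriveZ (alpha0 R)^-1 (is_derive_oint_bump t).
exact.
Qed.

Lemma smooth1_lam : smooth1 (@lam R).
Proof.
apply: smooth1_primitive is_derive_lam _ => r.
exact: CkM (Ck_cst _ _ _ _) (smooth1_bump r).
Qed.

(** The mean value theorem on [t, 0] produces a point c <= 0, where [bump] and hence the derivative
    of [lam] vanish. *)
Lemma lam_le0 t : t <= 0 -> lam t = 0.
Proof.
move=> t0; have [c /andP[_ c0]] := MVT_le is_derive_lam t0.
rewrite (bump_le0 c0) mulr0 mul0r /lam oint_id mulr0 => /eqP.
by rewrite sub0r oppr_eq0 => /eqP.
Qed.

Lemma lam_ge1 t : 1 <= t -> lam t = 1.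
Proof.
move=> t1; have [c /andP[c1 _]] := MVT_le is_derive_lam t1.
rewrite (bump_ge1 c1) mulr0 mul0r [lam 1]mulVf ?gt_eqF ?alpha0_gt0// => /eqP.
by rewrite subr_eq0 => /eqP.
Qed.

Lemma lam_ge0_le1 t : 0 <= lam t <= 1.
Proof.
have mono := @is_derive_ge0_le R _ _ _ _ is_derive_lam
  (fun z => mulr_ge0 (ltW (etrans (invr_gt0 _) alpha0_gt0)) (bump_ge0 z)).
apply/andP; split.
- have [t0|/ltW/mono] := leP t 0; first by rewrite lam_le0.
  by rewrite [lam 0]lam_le0.
- have [/mono|/ltW t1] := leP t 1; last by rewrite lam_ge1.
  by rewrite [lam 1]lam_ge1.
Qed.

Lemma is_derive_1B (f df : R -> R) t :
  (forall z, is_derive z (1 : R) f (df z)) ->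
  forall a, is_derive t 1 (fun z => f (a - z)) (- df (a - t)).
Proof.
move=> dfP a; have dB : is_derive t 1 (cst a - id) (0 - 1).
  exact: is_deriveB (is_derive_cst _ _ _) (is_derive_id _ _).
have := @is_derive1_comp R f (cst a - id) t _ _ (dfP (a - t)) dB.
by rewrite sub0r mulrN1.
Qed.

(** By [bump_sym] the left side has derivative 0; the constant is read off at t = 0. *)
Lemma lam_sym t : lam t + lam (1 - t) = 1.
Proof.
have d z : is_derive z (1 : R) (@lam R + (fun z => lam (1 - z))) 0.
  have := is_deriveD (is_derive_lam z) (is_derive_1B z is_derive_lam 1).
  by rewrite bump_sym subrr.
have -> : lam t + lam (1 - t) = lam 0 + lam (1 - 0).
  exact: is_derive_0_is_cst d.
by rewrite subr0 [lam 0]lam_le0// [lam 1]lam_ge1// add0r.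
Qed.

Lemma is_derive_oint_lam t : is_derive t 1 (oint 0 ^~ (@lam R)) (lam t).
Proof. exact/is_derive_oint/smooth1_continuous/smooth1_lam. Qed.

Lemma oint_lam_le0 t : t <= 0 -> oint 0 t (@lam R) = 0.
Proof.
move=> t0; have [c /andP[_ c0]] := MVT_le is_derive_oint_lam t0.
rewrite (lam_le0 c0) mul0r oint_id => /eqP.
by rewrite sub0r oppr_eq0 => /eqP.
Qed.

(* By symmetry of [lam], [F t - F (1 - t) - t] is constant for the primitive [F]
   of [lam]; its value at [t = 1/2] is [-1/2]. *)
Lemma oint_lam_ge1 t : 1 <= t -> oint 0 t (@lam R) = t - 2^-1.
Proof.
set F := oint 0 ^~ (@lam R) => t1.
have d z : is_derive z (1 : R) (F - (fun z => F (1 - z)) - id) 0.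
  have := is_deriveB (is_deriveB (is_derive_oint_lam z)
    (is_derive_1B z is_derive_oint_lam 1)) (is_derive_id z (1 : R)).
  by rewrite opprK lam_sym subrr.
have e := is_derive_0_is_cst t 2^-1 d.
have {e} : F t - F (1 - t) - t = F 2^-1 - F (1 - 2^-1) - 2^-1 by exact: e.
have -> : 1 - 2^-1 = 2^-1 :> R by lra.
rewrite subrr sub0r [F (1 - t)]oint_lam_le0 ?subr0; last by lra.
by rewrite -[oint _ _ _]/(F t); lra.
Qed.

(* The function [h] of the header. *)
Definition bnd s := s - 1 + phi (2 - s).

(** Unfolding [phi], the integral runs up to 1/2 + (2 - s) = 5/2 - s. *)
Lemma is_derive_bnd s : is_derive s 1 bnd (1 - lam (5 / 2 - s)).
Proof.
have := is_deriveD (is_deriveB (is_derive_id s (1 : R))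
  (is_derive_cst (1 : R) s (1 : R)))
  (is_derive_1B s is_derive_oint_lam (5 / 2)).
rewrite subr0; congr (is_derive _ _ _ _); apply/funext => z.
rewrite -[LHS]/(z - 1 + oint 0 (5 / 2 - z) (@lam R)).
by rewrite /bnd /phi; congr (_ + oint _ _ _); lra.
Qed.

Lemma smooth1_bnd : smooth1 bnd.
Proof.
apply: smooth1_primitive is_derive_bnd _ => r.
apply: CkB; first exact: Ck_cst.
have -> : (fun s => lam (5 / 2 - s)) = @lam R \o (cst (-1) * id + cst (5 / 2)).
  apply/funext => s; rewrite -[RHS]/(lam (-1 * s + 5 / 2)).
  by congr lam; ring.
exact: smooth1_comp smooth1_lam (smooth1_affine _ _) r.
Qed.

Lemma bnd_mono x y : x <= y -> bnd x <= bnd y.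
Proof.
apply: is_derive_ge0_le is_derive_bnd _ => z; rewrite subr_ge0.
by have /andP[] := lam_ge0_le1 (5 / 2 - z).
Qed.

Lemma bnd_lip x y : x <= y -> bnd y - bnd x <= y - x.
Proof.
move=> xy; have [c _ ->] := MVT_le is_derive_bnd xy.
rewrite -[leRHS]mul1r ler_wpM2r ?subr_ge0// lerBlDr lerDl.
by have /andP[] := lam_ge0_le1 (5 / 2 - c).
Qed.

(** Here 5/2 - s >= 1, so [phi (2 - s)] takes its linear value 2 - s. *)
Lemma bnd_le s : s <= 3 / 2 -> bnd s = 1.
Proof. by move=> s1; rewrite /bnd /phi oint_lam_ge1; lra. Qed.

Lemma bnd_ge s : 5 / 2 <= s -> bnd s = s - 1.
Proof. by move=> s1; rewrite /bnd /phi oint_lam_le0; lra. Qed.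

Lemma bnd_ge1 s : 1 <= bnd s.
Proof.
have [s1|/ltW/bnd_mono] := leP s (3 / 2); first by rewrite bnd_le.
by rewrite [bnd (3 / 2)]bnd_le.
Qed.

(** Equality holds at 5/2; going left from there, [bnd] falls no faster than s - 1 because its slope
    is at most 1. *)
Lemma bnd_geB1 s : s - 1 <= bnd s.
Proof.
have [s1|s1] := leP s (5 / 2); last by rewrite bnd_ge // ltW.
by have := bnd_lip s1; rewrite [bnd (5 / 2)]bnd_ge//; lra.
Qed.

(** The Lipschitz bound starting from 3/2. This gap of 1/2 is the margin that keeps |u| in the range
    where [rabs] is the identity. *)
Lemma bnd_gap s : 3 / 2 <= s -> bnd s <= s - 1 / 2.
Proof. by move=> /bnd_lip; rewrite [bnd (3 / 2)]bnd_le//; lra. Qed.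

(* The function [w] of the header: [|x|] made smooth in [x ^ 2] for [x >= 0]. *)
Definition rabs x := bnd (4 * x + 1) / 4.

Lemma rabs_mono x y : x <= y -> rabs x <= rabs y.
Proof. by move=> xy; rewrite ler_wpM2r// bnd_mono; lra. Qed.

Lemma rabs_ge x : 3 / 8 <= x -> rabs x = x.
Proof. by move=> x1; rewrite /rabs bnd_ge; lra. Qed.

Lemma rabs_le x : x <= 1 / 8 -> rabs x = 1 / 4.
Proof. by move=> x1; rewrite /rabs bnd_le; lra. Qed.

Lemma rabs_geid x : x <= rabs x.
Proof. by have := bnd_geB1 (4 * x + 1); rewrite /rabs; lra. Qed.

Lemma rabs_gt0 x : 0 < rabs x.
Proof. by have := bnd_ge1 (4 * x + 1); rewrite /rabs; lra. Qed.

Lemma smooth1_rabs : smooth1 rabs.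
Proof.
have -> : rabs = cst 4^-1 * (bnd \o (cst 4 * id + cst 1)).
  by apply/funext => x; rewrite /rabs mulrC.
move=> r; apply: CkM; first exact: Ck_cst.
exact: smooth1_comp smooth1_bnd (smooth1_affine _ _) r.
Qed.

Definition rabs_sqrt := rabs \o (@Num.sqrt R).

(** Near the singularity of the root the composite is constant: for x < 1/64 the root is below 1/8,
    including x < 0, where [Num.sqrt] is 0. *)
Lemma smooth1_rabs_sqrt : smooth1 rabs_sqrt.
Proof.
move=> r; pose U := [set x : R | x < 1 / 64]; pose U' := [set x : R | 0 < x].
have -> : setT = U `|` U'.
  apply/seteqP; split=> // x _; rewrite /U /U' /=.
  by have [x0|x0] := ltP 0 x; [right|left; lra].
apply: Ck_setU; [exact: open_lt|exact: open_gt| |].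
- apply: (@Ck_eq _ _ _ _ _ _ (cst (1 / 4 : R))); last exact: Ck_cst.
    exact: open_lt.
  move=> x xU; rewrite /rabs_sqrt /= rabs_le //.
  have -> : 1 / 8 = Num.sqrt (1 / 64) :> R.
    have -> : 1 / 64 = (1 / 8) ^+ 2 :> R by lra.
    by rewrite sqrtr_sqr ger0_norm; lra.
  by rewrite ler_wsqrtr // ltW.
- exact: Ck_comp (smooth1_rabs r) (Ck_sqrt r) _.
Qed.

End profile.

(** * Equivalence of [smooth_on] with membership in all classes [Ck] *)

Section smooth_on_Ck.
Context {R : realType}.

Lemma continuous_rVP (V : normedModType R) N (f : V -> 'rV[R]_N) x :
  {for x, continuous f} <-> forall i, {for x, continuous (fun y => f y ord0 i)}.
Proof.
split=> [cf i|cf].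
  apply: (@continuous_comp _ _ _ f (fun M : 'rV[R]_N => M ord0 i)) => //.
  exact: coord_continuous.
apply/cvgrPdist_le => e e0; near=> y.
rewrite /Num.Def.normr/= mx_normrE (bigmax_le _ (ltW e0))//= => -[j i] _.
rewrite ord1 !mxE/=; move: i; near: y; apply: filter_forall => i.
have /cvgrPdist_le := cf i; exact.
Unshelve. all: by end_near. Qed.

Lemma Ck_rVP (V : normedModType R) N r (B U : set V) (f : V -> 'rV[R]_N) :
  open U ->
  Ck r B U f <-> forall i, Ck r B U (fun y => f y ord0 i).
Proof.
move=> oU; elim: r f => [|r IH] f.
  split=> [[cf _] i|Cf]; split=> // x Ux.
    by move: i; apply/continuous_rVP; exact: cf.
  by apply/continuous_rVP => i; exact: (Cf i).1.
split=> [[cf df] i|Cf]; split.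
- by move=> x Ux; move: i; apply/continuous_rVP; exact: cf.
- move=> v Bv; have [f' df' Cf'] := df _ Bv.
  exists (fun y => f' y ord0 i); last by move: i; apply/IH.
  move=> x /df'[dx <-]; split; first exact: (derivable_mxP _ _ _).1 dx _ _.
  by rewrite derive_mx // mxE.
- by move=> x Ux; apply/continuous_rVP => i; exact: (Cf i).1.
move=> v Bv.
have der i x : U x -> derivable (fun y => f y ord0 i) x v.
  by have [f' df' _] := (Cf i).2 v Bv; move=> /df'[].
have derf x : U x -> derivable f x v.
  by move=> Ux; apply/derivable_mxP => j i; rewrite ord1; exact: der.
exists ('D_v f); first by move=> x /derf; exact: derivableP.
apply/IH => i; have [f' df' Cf'] := (Cf i).2 v Bv.
apply: Ck_eq Cf' => // x Ux.
by have [_ <-] := df' _ Ux; rewrite derive_mx ?mxE//; exact: derf.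
Qed.

(** The head of the list is the outermost derivative, whereas [Ck] differentiates [f] itself first;
    this lets lists be peeled at the innermost end. *)
Lemma ipartial_rcons k N (js : seq 'I_k) j (f : 'rV[R]_k -> 'rV[R]_N) :
  ipartial (rcons js j) f = ipartial js ('D_(ebasis R j) f).
Proof. by elim: js => //= a js ->. Qed.

Lemma smooth_onP k N (U : set 'rV[R]_k) (f : 'rV[R]_k -> 'rV[R]_N) : open U ->
  smooth_on U f <-> forall r, Ck r (range (@ebasis R k)) U f.
Proof.
move=> oU; split=> [sf r|Cf].
  elim: r f sf => [|r IH] f sf; first by split=> // x /(sf [::])[].
  split=> [x /(sf [::])[]//|_ [j _ <-]].
  exists ('D_(ebasis R j) f).
    by move=> x /(sf [::])[_ df]; exact: derivableP.
  by apply: IH => js x Ux; rewrite -ipartial_rcons; exact: sf.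
move=> js; elim/last_ind: js f Cf => [|js j IH] f Cf x Ux.
  split; first exact: (Cf 0%N).1.
  move=> j; have [|f' df' _] := (Cf 1%N).2 (ebasis R j); first by exists j.
  by have [] := df' _ Ux.
rewrite ipartial_rcons; apply: IH => // r.
have [|f' df' Cf'] := (Cf r.+1).2 (ebasis R j); first by exists j.
by apply: Ck_eq Cf' => // y /df'[_ <-].
Qed.

End smooth_on_Ck.

(** * The stretching map: smoothness and inversion *)

Section stretch.
Context {R : realType}.

Lemma enormZ k (c : R) (v : 'rV[R]_k) : enorm (c *: v) = `|c| * enorm v.
Proof.
rewrite /enorm -sqrtr_sqr -sqrtrM ?sqr_ge0// mulr_sumr.
by congr Num.sqrt; apply: eq_bigr => i _; rewrite mxE exprMn.
Qed.

Definition rnorm k (v : 'rV[R]_k) := rabs (enorm v).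

(** The norm is singular at 0, so the function is factored as [rabs_sqrt] after the sum of squares,
    a polynomial in the coordinates. *)
Lemma Ck_rnorm (V : normedModType R) k r (B U : set V) (p : V -> 'rV[R]_k) :
  (forall i, Ck r B U (fun x => p x ord0 i)) -> Ck r B U (fun x => rnorm (p x)).
Proof.
move=> Cp; have -> : (fun x => rnorm (p x)) =
    rabs_sqrt \o (\sum_(i < k) (fun x => p x ord0 i) ^+ 2).
  apply/funext => x; rewrite /rnorm /rabs_sqrt /enorm /=.
  congr (rabs (Num.sqrt _)).
  by rewrite fct_sumE; apply: eq_bigr.
apply: Ck_comp (smooth1_rabs_sqrt r) _ _ => //.
elim/big_ind: _ => [|f g|i _]; [exact: Ck_cst|exact: CkD|].
by rewrite expr2; exact: CkM.
Qed.

Variables n m : nat.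
Implicit Types (x : 'rV[R]_(n + m)) (c : R -> R).

Definition rsum x := rnorm (lsubmx x) + rnorm (rsubmx x).

Definition lscale c x :=
  1 + (rnorm (rsubmx x) - rnorm (c (rsum x) *: rsubmx x)) / rnorm (lsubmx x).

(** The function [c] is a parameter: [bnd] gives the forward map and its pointwise inverse gives the
    backward map. *)
Definition stretch c x : 'rV[R]_(n + m) :=
  row_mx (lscale c x *: lsubmx x) (c (rsum x) *: rsubmx x).

Lemma smooth_on_stretch c k (U : set 'rV[R]_k)
    (p : 'rV[R]_k -> 'rV[R]_(n + m)) :
  open U -> smooth1 c -> smooth_on U p -> smooth_on U (stretch c \o p).
Proof.
move=> oU sc /(smooth_onP _ oU) Cp; apply/smooth_onP => // r.
have {}Cp i := (Ck_rVP _ _ _ oU).1 (Cp r) i.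
have Cl i : Ck r (range (@ebasis R k)) U (fun y => lsubmx (p y) ord0 i).
  by apply: (Ck_eq oU _ (Cp (lshift m i))) => y _; rewrite mxE.
have Cr i : Ck r (range (@ebasis R k)) U (fun y => rsubmx (p y) ord0 i).
  by apply: (Ck_eq oU _ (Cp (rshift n i))) => y _; rewrite mxE.
have Wl := Ck_rnorm Cl; have Wr := Ck_rnorm Cr.
have CT : Ck r (range (@ebasis R k)) U (fun y => c (rsum (p y))).
  apply: (Ck_comp (f := fun y => rsum (p y))) (sc r) _ _ => //.
  exact: CkD Wl Wr.
have Cv i : Ck r (range (@ebasis R k)) U
    (fun y => (c (rsum (p y)) *: rsubmx (p y)) ord0 i).
  by apply: (Ck_eq oU _ (CkM CT (Cr i))) => y _; rewrite mxE.
have Wv := Ck_rnorm Cv.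
have Cs : Ck r (range (@ebasis R k)) U (fun y => lscale c (p y)).
  have Ci : Ck r (range (@ebasis R k)) U (fun y => (rnorm (lsubmx (p y)))^-1).
    apply: (Ck_comp (@Ck_inv R r) Wl) => y _.
    by rewrite /= gt_eqF // rabs_gt0.
  exact: CkD (Ck_cst r _ U (1 : R)) (CkM (CkB Wr Wv) Ci).
apply/Ck_rVP => // i; case: (split_ordP i) => j ->.
- by apply: (Ck_eq oU _ (CkM Cs (Cl j))) => y _; rewrite /= row_mxEl [RHS]mxE.
- by apply: (Ck_eq oU _ (Cv j)) => y _; rewrite /= row_mxEr.
Qed.

Lemma stretch_id c x : c (rsum x) = 1 -> stretch c x = x.
Proof.
move=> c1; rewrite /stretch /lscale c1 !scale1r subrr mul0r addr0.
by rewrite scale1r hsubmxK.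
Qed.

(** * The collar, where N(u) = |u| *)

Section collar.
Variables (c : R -> R) (x : 'rV[R]_(n + m)).
(** As T = N(u) + N(v), this says N(u) >= 1/2; the next bound does the same for the length that u
    has after stretching. *)
Hypothesis rv : rnorm (rsubmx x) <= rsum x - 1 / 2.
Hypothesis rcv : rnorm (c (rsum x) *: rsubmx x) <= rsum x - 1 / 2.

Let collar_gap : 1 / 2 <= rsum x - rnorm (c (rsum x) *: rsubmx x).
Proof. by rewrite lerBrDl -lerBrDr. Qed.

(** [rabs] is monotone and fixes 3/8, so |u| <= 3/8 would give N(u) <= 3/8 < 1/2. *)
Let enorm_l : enorm (lsubmx x) = rnorm (lsubmx x).
Proof.
have [a1|/ltW a1] := leP (3 / 8) (enorm (lsubmx x)).
  by rewrite /rnorm rabs_ge.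
have := rabs_mono a1; rewrite [rabs (3 / 8)]rabs_ge//.
move: rv; rewrite /rsum -[rabs _]/(rnorm _).
by move: (rnorm _) (rnorm _) => w s; lra.
Qed.

Let lscaleM : lscale c x * enorm (lsubmx x) =
  rsum x - rnorm (c (rsum x) *: rsubmx x).
Proof.
rewrite /lscale enorm_l mulrDl mulfVK; last by rewrite gt_eqF ?rabs_gt0.
by rewrite /rsum; ring.
Qed.

Lemma enorm_lsub_stretch : enorm (lsubmx (stretch c x)) =
  rsum x - rnorm (c (rsum x) *: rsubmx x).
Proof.
rewrite row_mxKl enormZ -lscaleM; congr (_ * _); apply: ger0_norm.
(* The sign of the factor is read off from [lscaleM]: its product with |u| > 0 is at least 1/2. *)
rewrite -(@pmulr_lge0 _ (enorm (lsubmx x))); last first.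
  by rewrite enorm_l rabs_gt0.
by rewrite lscaleM (le_trans _ collar_gap).
Qed.

Lemma rnorm_lsub_stretch : rnorm (lsubmx (stretch c x)) =
  rsum x - rnorm (c (rsum x) *: rsubmx x).
Proof.
rewrite -[LHS]/(rabs _) enorm_lsub_stretch rabs_ge //.
by apply: le_trans collar_gap; lra.
Qed.

Lemma rsum_stretch : rsum (stretch c x) = rsum x.
Proof. by rewrite [LHS]/rsum rnorm_lsub_stretch row_mxKr subrK. Qed.

(** Since T is unchanged, [c'] is evaluated at the same argument and restores v. That the two
    factors of u are inverse is checked after multiplying by |u| > 0. *)
Lemma stretchK c' : c' (rsum x) * c (rsum x) = 1 ->
  stretch c' (stretch c x) = x.
Proof.
move=> cc; have vE : c' (rsum x) *: (c (rsum x) *: rsubmx x) = rsubmx x.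
  by rewrite scalerA cc scale1r.
rewrite [LHS]/stretch rsum_stretch [rsubmx (stretch c x)]row_mxKr vE.
rewrite [in X in _ *: X]row_mxKl scalerA.
suff -> : lscale c' (stretch c x) * lscale c x = 1 by rewrite scale1r hsubmxK.
apply: (@mulIf _ (enorm (lsubmx x))); first by rewrite enorm_l gt_eqF ?rabs_gt0.
rewrite -mulrA lscaleM mul1r /lscale rsum_stretch rnorm_lsub_stretch.
rewrite row_mxKr vE mulrDl mulfVK; last first.
  by rewrite gt_eqF// (lt_le_trans _ collar_gap).
by rewrite enorm_l /rsum; ring.
Qed.

End collar.
End stretch.

(** * Passage between the two domains *)

Section diffeo.
Context {R : realType}.
Variables n m : nat.
Implicit Types x : 'rV[R]_(n + m).

Let T := @rsum R n m.
Let fwd := @stretch R n m bnd.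
Let bwd := @stretch R n m (GRing.inv \o bnd).

Lemma DDnmE x :
  DDnm x <-> enorm (rsubmx x) <= bnd (enorm (lsubmx x) + enorm (rsubmx x)).
Proof. by rewrite /DDnm /bnd /= opprD addrA; split; lra. Qed.

Lemma bnd_gt0 (s : R) : 0 < bnd s.
Proof. exact: lt_le_trans (bnd_ge1 s). Qed.

Lemma rabs_bnd (s : R) : rabs (bnd s) = bnd s.
Proof. by rewrite rabs_ge //; have := bnd_ge1 s; lra. Qed.

(** [rabs] is monotone and fixes [bnd s], which is at least 1; then [bnd_gap] applies. *)
Lemma rnorm_le_bnd k (v : 'rV[R]_k) s : 3 / 2 < s -> enorm v <= bnd s ->
  rnorm v <= s - 1 / 2.
Proof.
move=> s1 /rabs_mono vs; apply: le_trans vs _.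
by rewrite rabs_bnd bnd_gap // ltW.
Qed.

(** Membership involves |u| + |v|, while the maps use T, which is at least as large because N
    dominates the norm. *)
Lemma enorm_le_bnd x : DDnm x -> enorm (rsubmx x) <= bnd (T x).
Proof.
move=> /DDnmE /le_trans; apply; apply: bnd_mono.
by rewrite lerD // rabs_geid.
Qed.

Lemma fwd_collar x : RnDm x -> 3 / 2 < T x ->
  rnorm (rsubmx x) <= T x - 1 / 2 /\
  rnorm (bnd (T x) *: rsubmx x) <= T x - 1 / 2.
Proof.
move=> x1 Tx; split; apply: rnorm_le_bnd => //.
  exact: le_trans x1 (bnd_ge1 _).
by rewrite enormZ gtr0_norm ?bnd_gt0// ler_piMr // ltW // bnd_gt0.
Qed.

Lemma enorm_bwd_le1 x : DDnm x -> enorm ((bnd (T x))^-1 *: rsubmx x) <= 1.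
Proof.
move=> /enorm_le_bnd xT; rewrite enormZ gtr0_norm ?invr_gt0 ?bnd_gt0//.
by rewrite mulrC ler_pdivrMr ?bnd_gt0// mul1r.
Qed.

Lemma bwd_collar x : DDnm x -> 3 / 2 < T x ->
  rnorm (rsubmx x) <= T x - 1 / 2 /\
  rnorm ((bnd (T x))^-1 *: rsubmx x) <= T x - 1 / 2.
Proof.
move=> xD Tx; split; apply: rnorm_le_bnd => //; first exact: enorm_le_bnd.
exact: le_trans (enorm_bwd_le1 xD) (bnd_ge1 _).
Qed.

Lemma fwd_id x : T x <= 3 / 2 -> fwd x = x.
Proof. by move=> Tx; rewrite /fwd stretch_id// bnd_le. Qed.

Lemma bwd_id x : T x <= 3 / 2 -> bwd x = x.
Proof. by move=> Tx; rewrite /bwd stretch_id//= bnd_le// invr1. Qed.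

(** Let (u', v') be the image. If |v'| <= 1, then [bnd_ge1] suffices. Otherwise T > 3/2 and N(v') =
    |v'|, hence |u'| + |v'| = T, and |v'| = h(T) |v| <= h(T). *)
Lemma fwd_DDnm x : RnDm x -> DDnm (fwd x).
Proof.
move=> x1; apply/DDnmE.
have [b1|b1] := leP (enorm (rsubmx (fwd x))) 1.
  exact: le_trans b1 (bnd_ge1 _).
have [Tx|Tx] := leP (T x) (3 / 2).
  by move: b1; rewrite fwd_id // ltNge; move: x1 => /= ->.
have [rv rcv] := fwd_collar x1 Tx.
have rb : rnorm (rsubmx (fwd x)) = enorm (rsubmx (fwd x)).
  by rewrite /rnorm rabs_ge//; lra.
rewrite {2}/fwd enorm_lsub_stretch //.
(* Folds the scaled v back into the v-part of the image, so that the sum collapses to T. *)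
rewrite -[bnd _ *: _](row_mxKr (lscale bnd x *: lsubmx x)).
rewrite -[row_mx _ _]/(fwd x) rb subrK.
by rewrite row_mxKr enormZ gtr0_norm ?bnd_gt0// ler_piMr // ltW // bnd_gt0.
Qed.

Lemma bwd_RnDm x : DDnm x -> RnDm (bwd x).
Proof. by move=> xD; rewrite /RnDm /= row_mxKr enorm_bwd_le1. Qed.

Lemma fwdK x : RnDm x -> bwd (fwd x) = x.
Proof.
move=> x1; have [Tx|Tx] := leP (T x) (3 / 2); first by rewrite fwd_id// bwd_id.
have [rv rcv] := fwd_collar x1 Tx.
by apply: stretchK => //=; rewrite mulVf// gt_eqF// bnd_gt0.
Qed.

Lemma bwdK x : DDnm x -> fwd (bwd x) = x.
Proof.
move=> xD; have [Tx|Tx] := leP (T x) (3 / 2); first by rewrite bwd_id// fwd_id.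
have [rv rcv] := bwd_collar xD Tx.
by apply: stretchK => //=; rewrite mulfV// gt_eqF// bnd_gt0.
Qed.

Lemma smooth1_bndV : smooth1 (GRing.inv \o (@bnd R)).
Proof.
move=> r; apply: Ck_comp (@Ck_inv R r) (smooth1_bnd r) _ => s _ /=.
by rewrite gt_eqF // bnd_gt0.
Qed.

(** Composition with [stretch c] keeps any smooth map smooth, so [A] and [B] enter only through the
    inclusion of values. *)
Lemma dsmooth_stretch c (A B : set 'rV[R]_(n + m)) : smooth1 c ->
  (forall x, A x -> B (stretch c x)) -> dsmooth A B (stretch c).
Proof.
move=> sc AB; split=> // k U p [oU [sp pA]]; split=> //; split.
  exact: smooth_on_stretch.
by move=> x /pA /AB.
Qed.

End diffeo.

Theorem theorem3p5 (R : realType) (n m : nat) :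
  diffeomorphic (@RnDm R n m) (@DDnm R n m).
Proof.
exists (stretch bnd), (stretch (GRing.inv \o bnd)); split.
- exact: dsmooth_stretch (@smooth1_bnd R) (@fwd_DDnm R n m).
- exact: dsmooth_stretch (@smooth1_bndV R) (@bwd_RnDm R n m).
- exact: fwdK.
- exact: bwdK.
Qed.
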